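(* Let $X$ be a nonempty completely regular Hausdorff space and let $I$ be an ideal of $C(X)$ all of whose elements are divisors of zero. Then $I$ is contained in a proper $z^\circ$-ideal of $C(X)$.
   Context: $C(X)$ is the ring of all real-valued continuous functions on $X$. The element $0$ is counted as a divisor of zero, so the hypothesis says that every nonzero $f\in I$ satisfies $fg=0$ for some nonzero $g\in C(X)$. For an element $a$ of a commutative ring $R$ with identity, $P_a$ denotes the intersection of all minimal prime ideals of $R$ containing $a$ (with $P_a=R$ if there are none). An ideal $J$ of $R$ is a $z^\circ$-ideal if $P_a\subseteq J$ for each $a\in J$. *)

(* Defs.v *)
From HB Require Import structures.
From mathcomp Require Import all_boot all_order all_algebra.
From mathcomp Require Import all_classical all_reals topology normedtype.

Set Implicit Arguments.
Unset Strict Implicit.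
Unset Printing Implicit Defensive.

Import Order.TTheory GRing.Theory Num.Theory.
Import numFieldNormedType.Exports.

Local Open Scope classical_set_scope.
Local Open Scope ring_scope.

(* C(X) is [continuousType X R], as a subring of the ring [X -> R] with its
   pointwise operations.  It is only a [comPzRingType], because it is the zero
   ring when X is empty. *)
Section continuous_ring.
Context {X : topologicalType} {R : realType}.

Definition continuous_pred : {pred X -> R} :=
  mem [set f : X -> R | continuous f].

Let cts_sub (f : X -> R) (cf : f \in continuous_pred) : continuousType X R :=
  mkcts (set_mem cf : continuous f).

Let cts_rect (K : continuousType X R -> Type) :
  (forall f (cf : f \in continuous_pred), K (cts_sub cf)) -> forall u, K u.
Proof.
move=> Ksub u.
have cu : (u : X -> R) \in continuous_pred by rewrite inE; exact: cts_fun.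
by have -> : u = cts_sub cu by exact/continuousEP.
Qed.

Let cts_subK (f : X -> R) (cf : f \in continuous_pred) :
  cts_sub cf = f :> (X -> R).
Proof. by []. Qed.

HB.instance Definition _ :=
  isSub.Build (X -> R) continuous_pred (continuousType X R) cts_rect cts_subK.

Lemma continuous_subring_closed : subring_closed continuous_pred.
Proof.
split=> [|f g|f g]; rewrite !inE /=.
- by move=> x; exact: cvg_cst.
- by move=> cf cg x; apply: continuousB; [exact: cf | exact: cg].
- by move=> cf cg x; apply: continuousM; [exact: cf | exact: cg].
Qed.

HB.instance Definition _ := GRing.SubChoice_isSubComPzRing.Build
  (X -> R) continuous_pred (continuousType X R) continuous_subring_closed.

Implicit Types (f g : continuousType X R) (x : X).

Lemma continuous0E x : (0 : continuousType X R) x = 0. Proof. by []. Qed.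
Lemma continuous1E x : (1 : continuousType X R) x = 1. Proof. by []. Qed.
Lemma continuousNE f x : (- f) x = - f x. Proof. by []. Qed.
Lemma continuousDE f g x : (f + g) x = f x + g x. Proof. by []. Qed.
Lemma continuousME f g x : (f * g) x = f x * g x. Proof. by []. Qed.

End continuous_ring.

(* Unlike MathComp's [idealr], these ideals are arbitrary [Prop]-valued sets and
   may be the whole ring. *)
Section ideals.
Context {A : comPzRingType}.
Implicit Types (I J P Q : set A) (a b x y : A).

Definition ideal I : Prop :=
  [/\ I 0, forall x y, I x -> I y -> I (x + y) & forall a x, I x -> I (a * x)].

Definition prime_ideal P : Prop :=
  [/\ ideal P, P != setT & forall a b, P (a * b) -> P a \/ P b].

Definition minimal_prime_ideal P : Prop :=
  prime_ideal P /\ forall Q, prime_ideal Q -> Q `<=` P -> Q = P.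

Definition min_prime_hull a : set A :=
  \bigcap_(P in [set P | minimal_prime_ideal P /\ P a]) P.

Definition z0_ideal J : Prop :=
  ideal J /\ forall a, J a -> min_prime_hull a `<=` J.

Definition zero_divisor a : Prop :=
  a = 0 \/ exists2 b, b != 0 & a * b = 0.

End ideals.

(* Main.v *)
(** Call [b] subordinate to [a] when [Ann a] is contained in [Ann b].  In a
    reduced ring every element of [P_a] is subordinate to [a], because each
    nonzero element is avoided by some minimal prime.  In [C(X)] one has
    [Ann (a ^ 2 + b ^ 2) = Ann a] intersected with [Ann b], so the elements
    subordinate to some element of [I] form an ideal; it is proper because no
    element of [I] has zero annihilator. *)
Require Import Defs.
From mathcomp Require Import all_boot all_order all_algebra.
From mathcomp Require Import all_classical all_reals topology normedtype.
Import Order.TTheory GRing.Theory Num.Theory.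
Import numFieldNormedType.Exports.
Local Open Scope classical_set_scope.
Local Open Scope ring_scope.

(** These are the multiplicative sets avoiding [0]; complements of prime ideals are examples. *)
Definition proper_submonoid {A : comPzRingType} (S : set A) : Prop :=
  [/\ S 1, forall a b, S a -> S b -> S (a * b) & ~ S 0].

(** Zorn's lemma, with the powers of [x] as starting point. Anything larger than [S] still contains
    [x], so [S] is maximal among all proper submonoids. *)
Lemma maximal_proper_submonoid {A : comPzRingType} (x : A) :
  (forall n, x ^+ n != 0) ->
  exists S : set A, [/\ proper_submonoid S, S x &
    forall T, proper_submonoid T -> S `<=` T -> T = S].
Proof.
move=> x_nonnil.
(* The empty set is admitted since it is the union of the empty chain. *)
pose good (S : set A) := S !=set0 -> proper_submonoid S /\ S x.
have [F goodF totF|S [goodS maxS]] := @Zorn_bigcup A good.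
  have inF U y : F U -> U y -> proper_submonoid U /\ U x.
    by move=> FU Uy; apply: goodF => //; exists y.
  move=> [y [U FU Uy]]; have [[U1 _ _] Ux] := inF _ _ FU Uy.
  split; last by exists U.
  split; first by exists U.
    move=> a b [V FV Va] [W FW Wb].
    have [[_ VM _] _] := inF _ _ FV Va; have [[_ WM _] _] := inF _ _ FW Wb.
    have [VW|WV] := totF _ _ FV FW.
      by exists W => //; apply: WM => //; exact: VW.
    by exists V => //; apply: VM => //; exact: WV.
  by move=> [V FV V0]; have [[]] := inF _ _ FV V0.
have max T : proper_submonoid T -> T x -> S `<=` T -> T = S.
  move=> TP Tx ST; apply: contrapT => TS; apply: (maxS T) => //.
  by split=> // TleS; apply: TS; apply/seteqP.
have [S_ne|S_empty] := pselect (S !=set0).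
  have [SP Sx] := goodS S_ne; exists S; split=> // T TP ST.
  by apply: max => //; exact: ST.
(* An empty [S] lies inside the set of powers of [x], so maximality would make the two equal. *)
case: (S_empty); exists x; rewrite -(max (range (GRing.exp x))).
- by exists 1%N.
- split; first by exists 0%N.
    by move=> _ _ [m _ <-] [n _ <-]; exists (m + n)%N => //; rewrite exprD.
  by move=> [n _ /eqP]; apply/negP.
- by exists 1%N.
- by move=> y Sy; case: S_empty; exists y.
Qed.

(** In a reduced ring a nonzero [x] is not nilpotent, so some maximal proper submonoid contains it;
    the complement of that submonoid is the required prime. *)
Lemma minimal_prime_avoiding {A : comPzRingType}
    (reducedA : forall (y : A) n, y ^+ n = 0 -> y = 0) (x : A) :
  x != 0 -> exists P : set A, minimal_prime_ideal P /\ ~ P x.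
Proof.
move=> x0.
have [n|S [[S1 SM S0] Sx maxS]] := maximal_proper_submonoid x.
  by apply: contra_neq x0; exact: reducedA.
have SX a n : S a -> S (a ^+ n).
  by move=> Sa; elim: n => [|n IHn]; rewrite ?expr0 // exprS; exact: SM.
(* By maximality, the submonoid generated by [S] and [a] contains [0]. *)
have annP a : ~ S a -> exists2 s, S s & s * a = 0.
  move=> Sa; apply: contrapT => noann; apply: Sa.
  pose T := [set y | exists s n, S s /\ y = s * a ^+ n].
  have <- : T = S.
    apply: maxS => [|s Ss]; last by exists s, 0%N; rewrite expr0 mulr1.
    split; first by exists 1, 0%N; rewrite expr0 mulr1.
      move=> _ _ [s [m [Ss ->]]] [t [n [St ->]]]; exists (s * t), (m + n)%N.
      by split; [exact: SM|rewrite exprD mulrACA].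
    move=> [s [[|n] [Ss /esym sa0]]].
      by rewrite expr0 mulr1 in sa0; apply: S0; rewrite -sa0.
    (* From [s * a ^+ n.+1 = 0] follows [(s * a) ^+ n.+1 = 0], hence [s * a = 0] by reducedness. *)
    apply: noann; exists s => //; apply: (reducedA _ n.+1).
    by rewrite exprMn exprS -mulrA mulrCA sa0 mulr0.
  by exists 1, 1%N; rewrite expr1 mul1r.
exists (~` S); split; last by move/(_ Sx).
split; first split.
(* If [s] kills [a] and [t] kills [b], then [s * t] kills [a + b]; so [a + b] in [S] would put [0]
   in [S]. *)
- split=> // [a b /annP[s Ss sa0] /annP[t St tb0] Sab|a b /annP[s Ss sb0] Sab].
    apply: S0; rewrite -(_ : s * t * (a + b) = 0); first exact/SM/Sab/SM.
    by rewrite mulrDr mulrAC sa0 mul0r -mulrA tb0 mulr0 addr0.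
  apply: S0; rewrite -(_ : s * (a * b) = 0); first exact: SM.
  by rewrite mulrCA sb0 mulr0.
- by apply/eqP => ST; have : (~` S) 1 by rewrite ST.
- move=> a b Sab; have [Sa|] := pselect (S a); last by left.
  by right=> Sb; exact/Sab/SM.
(* The complement of a prime [Q] inside the complement of [S] is a proper submonoid containing [S],
   hence equals [S]. *)
- move=> Q [[Q0 _ QM] QT Qprime] QS; rewrite -[Q]setCK; congr (~` _).
  apply: maxS => [|s Ss /QS]; last exact.
  split=> [Q1|a b Qa Qb /Qprime[]//|]; last exact.
  by case/eqP: QT; apply/seteqP; split=> // a _; rewrite -[a]mulr1; exact: QM.
Qed.

(** Were [b * c] nonzero, a minimal prime [P] would avoid it. But [a * c = 0] puts [a] or [c] in
    [P], and [a] in [P] brings [b] along, so [b * c] lies in [P] after all. *)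
Lemma min_prime_hull_ann {A : comPzRingType}
    (reducedA : forall (y : A) n, y ^+ n = 0 -> y = 0) (a b c : A) :
  min_prime_hull a b -> a * c = 0 -> b * c = 0.
Proof.
move=> hull_b ac0; apply/eqP/negP => /negP.
move=> /(minimal_prime_avoiding reducedA)[P [Pmin Pbc]].
have [[[P0 _ PM] _ Pprime] _] := Pmin; apply: Pbc; rewrite mulrC.
have [Pa|Pc] : P a \/ P c by apply: Pprime; rewrite ac0.
  by apply: PM; exact: hull_b.
by rewrite mulrC; exact: PM.
Qed.

Lemma continuous_reduced {X : topologicalType} {R : realType}
    (f : continuousType X R) n :
  f ^+ n = 0 -> f = 0.
Proof.
have expE x : (f ^+ n) x = f x ^+ n.
  by elim: n => [|n IHn]; rewrite ?expr0 // !exprS continuousME IHn.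
move=> fn0; apply/continuousEP => x; rewrite continuous0E.
by have /eqP := expE x; rewrite fn0 eq_sym expf_eq0 => /andP[_ /eqP].
Qed.

(** At a point where [h] does not vanish, the sum of two real squares is zero, so both [f] and [g]
    vanish there. *)
Lemma continuous_ann_sqrD {X : topologicalType} {R : realType}
    (f g h : continuousType X R) :
  (f * f + g * g) * h = 0 -> f * h = 0 /\ g * h = 0.
Proof.
move=> fgh0.
have fgh0x x : (f x = 0 /\ g x = 0) \/ h x = 0.
  have : ((f * f + g * g) * h) x = 0 by rewrite fgh0.
  rewrite continuousME continuousDE !continuousME -!expr2 => /eqP.
  rewrite mulf_eq0 paddr_eq0 ?sqr_ge0// !sqrf_eq0.
  by move=> /orP[/andP[/eqP fx /eqP gx]|/eqP]; [left|right].
by split; apply/continuousEP => x; rewrite continuousME continuous0E;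
  have [[fx gx]|->] := fgh0x x; rewrite ?fx ?gx ?mul0r ?mulr0.
Qed.

Theorem corollary5p3 (R : realType) (X : topologicalType)
    (X_nonempty : [set: X] !=set0)
    (X_creg : completely_regular_space X) (X_haus : hausdorff_space X)
    (I : set (continuousType X R)) (I_ideal : ideal I)
    (I_zd : forall f, I f -> zero_divisor f) :
  exists J : set (continuousType X R),
    [/\ z0_ideal J, J != setT & I `<=` J].
Proof.
have [I0 ID IM] := I_ideal.
exists [set b | exists2 a, I a & forall c, a * c = 0 -> b * c = 0]; split.
- split; first split.
  + by exists 0.
  + move=> f g [a Ia fa] [b Ib gb].
    exists (a * a + b * b); first by apply: ID; exact: IM.
    move=> c /continuous_ann_sqrD[/fa fc0 /gb gc0].
    by rewrite mulrDl fc0 gc0 addr0.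
  + move=> g f [a Ia fa]; exists a => // c /fa fc0.
    by rewrite -mulrA fc0 mulr0.
  + move=> f [a Ia fa] g hull_g; exists a => // c /fa.
    exact: (min_prime_hull_ann continuous_reduced).
- apply/eqP => JT.
  have [a Ia ann1] : [set b | exists2 a, I a & forall c, a * c = 0 -> b * c = 0]
      (1 : continuousType X R) by rewrite JT.
  have [a0|[b /eqP b0 ab0]] := I_zd a Ia.
    (* For [a = 0] every element kills [a], which forces [1 = 0]; evaluation at a point of [X]
       refutes this. *)
    have [x _] := X_nonempty.
    have one0 : (1 : continuousType X R) = 0.
      by rewrite -[LHS]mul1r ann1 // a0 mul0r.
    have /eqP : (1 : continuousType X R) x = 0 by rewrite one0.
    by rewrite continuous1E oner_eq0.
  by apply: b0; rewrite -[b]mul1r; exact: ann1.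
- by move=> a Ia; exists a.
Qed.
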